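(* Let $f\in C(\mathbb R\times\mathbb R,\mathbb R)$. Suppose that: - $f$ is positively Lagrange stable; - $f$ is remotely almost periodic (respectively, remotely $\tau$-periodic with a given $\tau>0$, or remotely stationary) in $t\in\mathbb R$ uniformly with respect to $u$ on every compact subset of $\mathbb R$; - the $\omega$-limit set $\omega_f$ of $f$ is a minimal set of the shift dynamical system $(C(\mathbb R\times\mathbb R,\mathbb R),\mathbb R,\sigma)$; - $f$ is monotone, i.e., $x_1\le x_2$ implies $f(t,x_1)\le f(t,x_2)$ for all $t\in\mathbb R$ and $x_1,x_2\in\mathbb R$, and $f$ is regular; - for some $u_0\in\mathbb R$ the solution $\varphi(t,u_0,f)$ of the equation $u'=f(t,u)$ with $\varphi(0,u_0,f)=u_0$ is bounded on $\mathbb R_{+}$. Then the function $t\mapsto\varphi(t,u_0,f)$, $t\in\mathbb R_+$, is remotely almost periodic (respectively, remotely $\tau$-periodic, or remotely stationary).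
   Context: $\mathbb R_+=[0,+\infty)$. $C(\mathbb R\times\mathbb R,\mathbb R)$ carries the compact-open topology (which is completely metrizable), and the shift dynamical system on it is $\sigma(h,f)=f^h$, $f^h(t,x):=f(t+h,x)$, $h\in\mathbb R$. $H(f)$ is the closure of $\{f^h:h\in\mathbb R\}$. $f$ is positively Lagrange stable if $\{f^h: h\ge 0\}$ is precompact in $C(\mathbb R\times\mathbb R,\mathbb R)$. $\omega_f$ is the set of all limits of sequences $f^{h_k}$ with $h_k\to+\infty$. $\omega_f$ is minimal if for every $g\in\omega_f$ the trajectory $\{g^h:h\in\mathbb R\}$ is dense in $\omega_f$. $f$ is regular if for every $g\in H(f)$ and $u\in\mathbb R$ there exists a unique solution $\varphi(t,u,g)$ of $x'=g(t,x)$ with $\varphi(0,u,g)=u$, defined on $\mathbb R_+$. $f$ is remotely almost periodic in $t$ uniformly with respect to $u$ on compacts if for every $\varepsilon>0$ and every compact $Q\subset\mathbb R$ there is $l>0$ such that every segment $[a,a+l]$, $a\in\mathbb R$, contains a number $s$ for which there is $L>0$ with $|f(t+s,u)-f(t,u)|<\varepsilon$ for all $t\ge L$, $u\in Q$. $f$ is remotely $\tau$-periodic in $t$ uniformly on compacts if for every compact $Q$, $\lim_{t\to+\infty}\sup_{u\in Q}|f(t+\tau,u)-f(t,u)|=0$; it is remotely stationary if this holds for every $\tau>0$. A continuous function $\varphi:\mathbb R_+\to\mathbb R$ is remotely almost periodic if for every $\varepsilon>0$ there is $l>0$ such that every segment $[a,a+l]$, $a\ge 0$, contains a number $s$ for which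 there is $L>0$ with $|\varphi(t+s)-\varphi(t)|<\varepsilon$ for all $t\ge L$; remotely $\tau$-periodic if $\lim_{t\to+\infty}|\varphi(t+\tau)-\varphi(t)|=0$; remotely stationary if it is remotely $s$-periodic for every $s>0$. *)

(* Defs.v *)
From HB Require Import structures.
From mathcomp Require Import all_boot all_order all_algebra.
From mathcomp Require Import all_classical all_reals all_analysis.

Set Implicit Arguments.
Unset Strict Implicit.
Unset Printing Implicit Defensive.

Import Order.TTheory GRing.Theory Num.Theory.
Import numFieldNormedType.Exports.

(* Puts the compact-open topology on [continuousType]. *)
Import ArrowAsCompactOpen.

Local Open Scope classical_set_scope.
Local Open Scope ring_scope.

(* The phase space C(R x R, R); the value of f at (t, x) is [f (t, x)]. *)
Notation CRR R := (continuousType (prod R R) R).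

Section ShiftSystem.
Context {R : realType}.

Definition time_translation (h : R) (p : R * R) : R * R := (p.1 + h, p.2).

Lemma time_translation_continuous (h : R) : continuous (time_translation h).
Proof.
move=> [t x]; rewrite /time_translation.
apply: (cvg_pair (f := fun p : R * R => p.1 + h) (g := snd)
  (G := nbhs (t + h)) (H := nbhs x)).
  by apply: cvgD; [exact: cvg_fst | exact: cvg_cst].
exact: cvg_snd.
Qed.

HB.instance Definition _ (h : R) :=
  @isContinuous.Build (R * R)%type (R * R)%type (time_translation h)
    (@time_translation_continuous h).

Definition shift (h : R) (f : CRR R) : CRR R := f \o time_translation h.

Lemma shiftE (h : R) (f : CRR R) (t x : R) : shift h f (t, x) = f (t + h, x).
Proof. by []. Qed.

Definition trajectory (f : CRR R) : set (CRR R) := [set shift h f | h in [set: R]].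

Definition hull (f : CRR R) : set (CRR R) := closure (trajectory f).

Definition pos_Lagrange_stable (f : CRR R) : Prop :=
  precompact [set shift h f | h in [set h : R | 0 <= h]].

Definition omega_set (f : CRR R) : set (CRR R) :=
  [set g | exists2 h : nat -> R,
     h k @[k --> \oo] --> +oo & shift (h k) f @[k --> \oo] --> g].

Definition minimal_omega (f : CRR R) : Prop :=
  forall g, omega_set f g -> omega_set f `<=` closure (trajectory g).

End ShiftSystem.

Section Equation.
Context {R : realType}.

(* A function on R_+ is represented by a function on R of which only the values
   at t >= 0 matter; the derivative is taken relative to R_+, so it is one-sided
   at t = 0. *)
Definition solution (g : CRR R) (u : R) (phi : R -> R) : Prop :=
  phi 0 = u /\
  forall t : R, 0 <= t ->
    (phi s - phi t) / (s - t) @[s --> within [set s : R | 0 <= s] t^']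
      --> g (t, phi t).

Definition regular_field (f : CRR R) : Prop :=
  forall (g : CRR R) (u : R), hull f g ->
    exists2 phi : R -> R, solution g u phi &
      forall psi : R -> R, solution g u psi ->
        forall t : R, 0 <= t -> psi t = phi t.

Definition monotone_field (f : CRR R) : Prop :=
  forall t x1 x2 : R, x1 <= x2 -> f (t, x1) <= f (t, x2).

Definition bounded_on_Rplus (phi : R -> R) : Prop :=
  exists M : R, forall t : R, 0 <= t -> `|phi t| <= M.

End Equation.

Section RemoteRecurrenceField.
Context {R : realType}.

Definition field_remotely_almost_periodic (f : CRR R) : Prop :=
  forall (eps : R) (Q : set R), 0 < eps -> compact Q ->
    exists2 l : R, 0 < l &
      forall a : R, exists2 s : R, a <= s <= a + l &
        exists2 L : R, 0 < L &
          forall t u : R, L <= t -> Q u -> `|f (t + s, u) - f (t, u)| < eps.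

Definition field_remotely_periodic (tau : R) (f : CRR R) : Prop :=
  forall Q : set R, compact Q ->
    sup [set `|f (t + tau, u) - f (t, u)| | u in Q] @[t --> +oo] --> (0 : R).

Definition field_remotely_stationary (f : CRR R) : Prop :=
  forall tau : R, 0 < tau -> field_remotely_periodic tau f.

End RemoteRecurrenceField.

Section RemoteRecurrence.
Context {R : realType}.

Definition remotely_almost_periodic (phi : R -> R) : Prop :=
  {within `[0, +oo[, continuous phi} /\
  forall eps : R, 0 < eps ->
    exists2 l : R, 0 < l &
      forall a : R, 0 <= a -> exists2 s : R, a <= s <= a + l &
        exists2 L : R, 0 < L &
          forall t : R, L <= t -> `|phi (t + s) - phi t| < eps.

Definition remotely_periodic (tau : R) (phi : R -> R) : Prop :=
  {within `[0, +oo[, continuous phi} /\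
  `|phi (t + tau) - phi t| @[t --> +oo] --> (0 : R).

Definition remotely_stationary (phi : R -> R) : Prop :=
  forall tau : R, 0 < tau -> remotely_periodic tau phi.

End RemoteRecurrence.

(* Main.v *)
(** If the translates [f^a] and [f^b] are close, monotonicity makes the gap
    [phi a - phi b], when positive, almost nondecreasing under a simultaneous
    time shift. Let [D] be the limit, as [K] grows, of the largest gap
    [phi a - phi b] over times [a, b >= K] with [f^a] and [f^b] [1/K]-close.
    Minimality of [omega_f] makes pairs [(a, b)] that almost realize [D] recur
    near every late time [t]. A shift by a fixed [s] can neither decrease the
    gaps [phi a - phi b], [phi a - phi t], [phi t - phi b] appreciably nor push
    the first, which is the sum of the other two, above [D], so all three are
    almost preserved. If moreover [f^(t+s)] is close to [f^t] for all late [t],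
    then the bound [D] applied to the pairs [(a, b + s)] and [(a + s, b)] forces
    [phi (b + s)] to be close to [phi b], hence [phi (t + s)] to be close to
    [phi t]. How close [f^(t+s)] and [f^t] must be does not depend on [s], so
    the three recurrence properties pass from [f] to [phi]. *)

Require Import Defs.
From mathcomp Require Import all_boot all_order all_algebra.
From mathcomp Require Import all_classical all_reals all_analysis.
From mathcomp Require Import ring lra.
Set Implicit Arguments.
Unset Strict Implicit.
Unset Printing Implicit Defensive.

Import Order.TTheory GRing.Theory Num.Theory.
Import numFieldNormedType.Exports.
Import Defs ArrowAsCompactOpen.

Local Open Scope classical_set_scope.
Local Open Scope ring_scope.

(* The radius of the box and the precision are tied to the single parameter [N]:
   these sets form a neighbourhood basis of the compact-open topology. *)
Definition close_on {R : realType} (N : R) (g g' : CRR R) : Prop :=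
  forall r x : R, `|r| <= N -> `|x| <= N -> `|g (r, x) - g' (r, x)| < N^-1.

(** * Basic neighbourhoods of the compact-open topology *)

Section CloseOn.
Context {R : realType}.
Implicit Types (N h : R) (g : CRR R).

Lemma close_on_refl N g : 0 < N -> close_on N g g.
Proof. by move=> N0 r x _ _; rewrite subrr normr0 invr_gt0. Qed.

Lemma close_on_sym N g g' : close_on N g g' -> close_on N g' g.
Proof. by move=> c r x hr hx; rewrite distrC; exact: c. Qed.

Lemma close_on_le N N' g g' : 0 < N -> N <= N' ->
  close_on N' g g' -> close_on N g g'.
Proof.
move=> N0 NN' c r x hr hx.
apply: lt_le_trans (c r x (le_trans hr NN') (le_trans hx NN')) _.
by rewrite lef_pV2 ?posrE//; exact: lt_le_trans NN'.
Qed.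

Lemma close_on_trans N g1 g2 g3 : 0 < N ->
  close_on (2 * N) g1 g2 -> close_on (2 * N) g2 g3 -> close_on N g1 g3.
Proof.
move=> N0 c12 c23 r x hr hx.
have N2 : N <= 2 * N by lra.
have := c12 r x (le_trans hr N2) (le_trans hx N2).
have := c23 r x (le_trans hr N2) (le_trans hx N2).
have -> : g1 (r, x) - g3 (r, x) =
  (g1 (r, x) - g2 (r, x)) + (g2 (r, x) - g3 (r, x)) by ring.
have -> : N^-1 = (2 * N)^-1 + (2 * N)^-1 by field; lra.
move=> h1 h2; apply: le_lt_trans (ler_normD _ _) _; exact: ltrD.
Qed.

Lemma close_on_shift N N' h g g' : 0 < N -> N + `|h| <= N' ->
  close_on N' g g' -> close_on N (shift h g) (shift h g').
Proof.
move=> N0 hN c r x hr hx; rewrite !shiftE.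
have h0 := normr_ge0 h.
have NN' : N <= N' by lra.
apply: lt_le_trans (c _ x _ (le_trans hx NN')) _; first by
  apply: le_trans (ler_normD _ _) _; lra.
by rewrite lef_pV2 ?posrE//; exact: lt_le_trans NN'.
Qed.

Lemma shiftD (a b : R) g : shift a (shift b g) = shift (b + a) g.
Proof.
apply/continuousEP => -[t x]; rewrite !shiftE.
by rewrite -addrA (addrC a).
Qed.

(** At a continuous function, compact-open convergence is uniform convergence on compacts, used here
    on the square of half-side [N]. *)
Lemma nbhs_close_on N g : 0 < N -> nbhs g (close_on N g).
Proof.
move=> N0.
have cg : continuous (g : R * R -> R) by exact: cts_fun.
have C : compact (`[- N, N] `*` `[- N, N] : set (R * R)).
  by apply: compact_setX; exact: segment_compact.
have F : Filter ((fun g' : CRR R => g' : R * R -> R) @ nbhs g) by exact: fmap_filter.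
have /(compact_open_fam_compactP cg F) cv :
    {compact-open, (fun g' : CRR R => g' : R * R -> R) @ nbhs g --> (g : R * R -> R)}.
  exact: (@initial_continuous (CRR R) ({compact-open, (R * R)%type -> R}) (fun g' => g')).
have E : entourage [set uv : R * R | ball uv.1 N^-1 uv.2].
  by rewrite -entourage_ballE; exists N^-1 => //=; rewrite invr_gt0.
have := cv _ (@fam_nbhs _ _ compact _ _ (g : R * R -> R) E C).
apply: (@filterS _ (nbhs g)) => g' /= h r x hr hx.
by apply: h; rewrite /= !in_itv/= -!ler_norml.
Qed.

End CloseOn.

(** * Regularity of solutions and a one-sided growth estimate *)

Section Solutions.
Context {R : realType}.
Implicit Types (f : CRR R) (phi : R -> R).

Lemma solution_is_derive f u phi (t : R) : solution f u phi -> 0 < t ->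
  is_derive t 1 phi (f (t, phi t)).
Proof.
move=> [_ sol] t0.
suff cv : h^-1 *: (phi (h *: 1 + t) - phi t) @[h --> 0^'] --> f (t, phi t).
  by split; [exact: cvgP cv | exact: cvg_lim cv].
apply/cvgrPdist_lt => e e0.
have /cvgrPdist_lt/(_ e e0) := sol t (ltW t0).
rewrite near_withinE /dnbhs near_withinE => /nbhs_ballP[d /= d0 hd].
(* A radius at most [t] keeps [h + t] nonnegative, so the quotient taken within R_+ yields a
   two-sided derivative. *)
rewrite near_withinE; apply/nbhs_ballP; exists (Num.min d t).
  by rewrite /= lt_min d0.
move=> h; rewrite /ball/= sub0r normrN lt_min => /andP[hd' ht] h0.
have := hd (h + t); rewrite /ball/= opprD addrCA subrr addr0 normrN => /(_ hd').
have -> : (h *: 1 + t : R) = h + t by rewrite /GRing.scale/= mulr1.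
rewrite addrK /= mulrC; apply.
- by apply: contra_neq h0; lra.
- by move: ht; rewrite ltr_norml; lra.
Qed.

Lemma solution_continuous f u phi :
  solution f u phi -> {within `[0, +oo[, continuous phi}.
Proof.
move=> [_ sol]; apply/subspace_continuousP => t /=.
rewrite in_itv/= andbT => t0.
have cv : (phi s - phi t) / (s - t) * (s - t) + phi t
    @[s --> within [set s : R | 0 <= s] t^'] --> f (t, phi t) * (t - t) + phi t.
  apply: cvgD; last exact: cvg_cst.
  apply: cvgM; first exact: sol.
  apply: cvgB; last exact: cvg_cst.
  apply: cvg_within_filter; exact: cvg_within_filter.
move: cv; rewrite subrr mulr0 add0r => /cvgrPdist_lt cv.
apply/cvgrPdist_lt => e e0; move: (cv e e0).
rewrite !near_withinE; apply: filterS => s /= h.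
rewrite in_itv/= andbT => s0.
have [->|st] := eqVneq s t; first by rewrite subrr normr0.
by have := h st s0; rewrite divfK ?subr_eq0// subrK.
Qed.

(** Meant for the gap between two translates of a solution, whose derivative is bounded below only
    while the gap is positive. *)
Lemma decrease_le_while_positive (F dF : R -> R) (eta s : R) :
  0 <= s -> 0 <= eta ->
  (forall r, 0 <= r <= s -> is_derive r 1 F (dF r)) ->
  (forall r, 0 <= r <= s -> 0 < F r -> - eta <= dF r) ->
  eta * s < F 0 -> F 0 - eta * s <= F s.
Proof.
move=> s0 eta0 dF_ pos F0.
have es : 0 <= eta * s by exact: mulr_ge0.
(* [F] is positive up to its first zero, where this bound would contradict the
   assumption on [F 0]. *)
have mvt r0 : 0 <= r0 <= s -> (forall r, 0 < r < r0 -> 0 < F r) ->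
    F 0 - eta * s <= F r0.
  move=> /andP[]; rewrite le_eqVlt => /predU1P[<- _ _|r00 r0s posr]; first lra.
  have in0s x : 0 <= x <= r0 -> 0 <= x <= s by move=> /andP[? ?]; apply/andP; lra.
  have [|||c] := @MVT R F dF 0 r0 => //.
  - by move=> x; rewrite in_itv/= => /andP[? ?]; apply/dF_/in0s/andP; lra.
  - apply: derivable_within_continuous => x; rewrite in_itv/= => xr.
    by have [] := dF_ x (in0s x xr).
  rewrite in_itv/= => cr; rewrite subr0 => Fr.
  have cs : 0 <= c <= s by apply: in0s; case/andP: cr => ? ?; apply/andP; lra.
  have := pos c cs (posr c cr); nra.
apply: (mvt s); first by rewrite s0 lexx.
apply: contrapT => /existsNP[r1 /not_implyP[/andP[r10 r1s] /negP]].
rewrite -leNgt => Fr1.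
pose A := [set r | 0 <= r <= s /\ F r <= 0].
have A1 : A r1 by split => //; apply/andP; lra.
have lA : lbound A 0 by move=> r [/andP[]].
have iA : has_inf A by split; [exists r1 | exists 0].
have rA0 : 0 <= inf A by apply: lb_le_inf => //; exists r1.
have rAs : inf A <= s by apply: (le_trans (ge_inf _ A1)); [exists 0 | exact: ltW].
have inA : 0 <= inf A <= s by rewrite rA0.
have Fpos : 0 < F (inf A).
  suff : F 0 - eta * s <= F (inf A) by lra.
  apply: (mvt (inf A)) => // r /andP[r0 rA]; rewrite ltNge; apply/negP => Fr.
  have : A r by split => //; apply/andP; lra.
  by move=> /(ge_inf (ex_intro _ 0 lA)); lra.
have cF : {for inf A, continuous F}.
  by apply/differentiable_continuous/derivable1_diffP; have [] := dF_ _ inA.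
have /nbhs_ballP[d /= d0 hd] : nbhs (inf A) [set r | 0 < F r].
  exact: (cF _ (lt_nbhsr Fpos)).
have [r Ar rd] := inf_adherent d0 iA.
have rA := ge_inf (ex_intro _ 0 lA) Ar.
have : 0 < F r by apply: hd; rewrite /ball/= ltr_distl; apply/andP; lra.
by case: Ar => _; lra.
Qed.
End Solutions.

(** * Gaps along a solution, limits of translates, recurrence from minimality *)

Section Translates.
Context {R : realType}.
Implicit Types (f g : CRR R).

(** While the gap is positive, monotonicity allows [phi (a + r)] to be lowered to [phi (b + r)]
    inside [f]. What remains compares [f] at two times in the same state and costs at most [K^-1];
    [M <= K] and [s <= K] keep this comparison inside the box of [close_on]. *)
Lemma solution_gap f u phi (M K a b s : R) :
  monotone_field f -> solution f u phi ->
  (forall t, 0 <= t -> `|phi t| <= M) -> 0 < K -> M <= K ->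
  0 < a -> 0 < b -> close_on K (shift a f) (shift b f) -> 0 <= s <= K ->
  s / K < phi a - phi b ->
  phi a - phi b - s / K <= phi (a + s) - phi (b + s).
Proof.
move=> mono sol bnd K0 MK a0 b0 cab /andP[s0 sK] gap.
pose F r := phi (a + r) - phi (b + r).
pose dF r := f (a + r, phi (a + r)) - f (b + r, phi (b + r)).
have K0' : 0 <= K^-1 by rewrite invr_ge0 ltW.
have := @decrease_le_while_positive R F dF K^-1 s s0 K0'.
rewrite /F !addr0 (mulrC _ s); apply => //.
- move=> r /andP[r0 rs].
  have dphi (c : R) : 0 < c ->
      is_derive r 1 (fun x => phi (c + x)) (f (c + r, phi (c + r))).
    move=> c0; rewrite -[f _]mulr1.
    apply: (@is_derive1_comp _ phi (fun x => c + x)).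
      by apply: solution_is_derive sol _; lra.
    by rewrite -[1 in X in is_derive _ _ _ X]add0r; exact: is_deriveD.
  exact: (is_deriveB (dphi a a0) (dphi b b0)).
- move=> r /andP[r0 rs] Fr.
  have br : 0 <= b + r by lra.
  have := cab r (phi (b + r)) _ (le_trans (bnd _ br) MK).
  rewrite !shiftE ger0_norm// ltr_norml (addrC r a) (addrC r b) /dF.
  move=> /(_ (le_trans rs sK)) /andP[lo _].
  by have := mono (a + r) (phi (b + r)) (phi (a + r)); lra.
Qed.

(** A cluster point suffices: [kappa n] picks an index beyond [n] in its [n]-th neighbourhood, and
    [kappa] need not be increasing. *)
Lemma precompact_translates f (h : nat -> R) :
  pos_Lagrange_stable f -> (forall k, 0 <= h k) ->
  exists g (kappa : nat -> nat), forall n,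
    (n <= kappa n)%N /\ close_on n.+1%:R (shift (h (kappa n)) f) g.
Proof.
rewrite /pos_Lagrange_stable precompactE => cpt h0.
pose F := (fun k => shift (h k) f) @ \oo.
have PF : ProperFilter F by apply: fmap_proper_filter; exact: eventually_filter.
have [|g [_ clg]] := cpt F PF.
  by exists 0%N => // k _; apply: subset_closure; exists (h k) => //=.
suff /choice[kappa Hk] : forall n : nat, exists k,
    (n <= k)%N /\ close_on n.+1%:R (shift (h k) f) g by exists g, kappa.
move=> n; have n0 : 0 < n.+1%:R :> R by [].
have Fn : F [set shift (h k) f | k in [set k | (n <= k)%N]].
  by exists n => // k nk; exists k.
have [_ [[k nk <-] gk]] := clg _ _ Fn (nbhs_close_on g n0).
by exists k; split => //; exact: close_on_sym.
Qed.

Lemma cvg_close_on (F : nat -> CRR R) g :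
  (forall n, close_on n.+1%:R (F n) g) -> F n @[n --> \oo] --> g.
Proof.
move=> cF.
have cg : continuous (g : R * R -> R) by exact: cts_fun.
have cv : {compact-open, (F n : R * R -> R) @[n --> \oo] --> (g : R * R -> R)}.
  apply/(compact_open_fam_compactP cg); apply/fam_cvgP => K cK.
  move=> P /uniform_nbhs[E [+ sub]].
  rewrite -entourage_ballE => -[e /= e0 ballE].
  have [B KB] : exists B : R, forall p, K p -> `|p| <= B.
    have [B [_ HB]] := compact_bounded cK.
    by exists (B + 1) => p Kp; apply: HB => //; rewrite ltrDl.
  near=> n; apply: sub => -[t x] Ktx; apply: ballE; rewrite /ball/=.
  have := KB _ Ktx; rewrite prod_normE/= ge_max => /andP[tB xB].
  have Bn : B <= n.+1%:R.
    by apply: (@le_trans _ _ n%:R); [near: n; exact: nbhs_infty_ger | rewrite ler_nat].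
  rewrite distrC; apply: lt_le_trans (cF n t x (le_trans tB Bn) (le_trans xB Bn)) _.
  rewrite -[e]invrK lef_pV2 ?posrE ?invr_gt0//.
  by apply: (@le_trans _ _ n%:R); [near: n; exact: nbhs_infty_ger | rewrite ler_nat].
(* The topology of [CRR R] is induced from the function space, so [A] contains the trace of an open
   [B]. *)
move=> A [_ [[B oB <-] /= Bg BA]].
have : nbhs (g : {compact-open, (R * R)%type -> R}) B by exact: open_nbhs_nbhs.
by move=> /cv[m _ Bm]; exists m => // n mn; apply: BA; exact: Bm.
Unshelve. all: by end_near. Qed.

Lemma omega_set_close_on f g (h : nat -> R) : (forall n, n%:R <= h n) ->
  (forall n, close_on n.+1%:R (shift (h n) f) g) -> omega_set f g.
Proof.
move=> hn cg; exists h; last exact: cvg_close_on.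
apply/cvgryPge => A; near=> n; apply: le_trans (hn n).
by near: n; exact: nbhs_infty_ger.
Unshelve. all: by end_near. Qed.

(** Otherwise, for each [k], some window of length [2 * k] misses its target. Translates at the
    window midpoints and at the targets accumulate at [g] and [g'] in [omega_set f]. Minimality
    brings some translate of [g] by [h] close to [g']; starting from the midpoint, a large window
    contains that time whatever the sign of [h]. *)
Lemma minimal_omega_recurrence f (N : R) :
  pos_Lagrange_stable f -> minimal_omega f -> 0 < N ->
  exists S T : R, 0 <= S /\ forall t t' : R, T <= t -> T <= t' ->
    exists2 r, 0 <= r <= S & close_on N (shift (t + r) f) (shift t' f).
Proof.
move=> Lag mini N0; apply: contrapT => H.
have /choice[tt Htt] : forall k : nat, exists tt : R * R,
    [/\ k%:R <= tt.1, k%:R <= tt.2 & forall r, 0 <= r <= 2 * k%:R ->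
      ~ close_on N (shift (tt.1 + r) f) (shift tt.2 f)].
  move=> k; apply: contrapT => Hk; apply: H; exists (2 * k%:R), k%:R.
  split=> [|t t' kt kt']; first exact: mulr_ge0.
  apply: contrapT => Hr; apply: Hk; exists (t, t'); split => //= r r0 c.
  by apply: Hr; exists r.
have [k|g [k1 Hk1]] := @precompact_translates f (fun k => (tt k).1 + k%:R) Lag.
  by have [h _ _] := Htt k; rewrite addr_ge0// (le_trans _ h).
have [k|g' [k2 Hk2]] := @precompact_translates f (fun k => (tt (k1 k)).2) Lag.
  by have [_ h _] := Htt (k1 k); rewrite (le_trans _ h).
have nk n : (n <= k1 (k2 n))%N.
  by apply: leq_trans (Hk2 n).1 _; exact: (Hk1 _).1.
pose k n := k1 (k2 n).
have cg n : close_on n.+1%:R (shift ((tt (k n)).1 + (k n)%:R) f) g.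
  apply: close_on_le (Hk1 (k2 n)).2 => //.
  by rewrite ler_nat ltnS; exact: (Hk2 n).1.
have og : omega_set f g.
  apply: omega_set_close_on cg => n; have [h _ _] := Htt (k n).
  have : n%:R <= (k n)%:R :> R by rewrite ler_nat.
  by have : 0 <= (k n)%:R :> R by []; lra.
have og' : omega_set f g'.
  apply: omega_set_close_on (fun n => (Hk2 n).2) => n.
  by have [_ h _] := Htt (k n); apply: le_trans h; rewrite ler_nat.
have N4 : 0 < 2 * (2 * N) by lra.
have [_ [[h _ <-] ch]] := mini g og g' og' _ (nbhs_close_on g' N4).
have h0 := normr_ge0 h.
pose B := 2 * (2 * N) + `|h|.
have B0 : 0 <= B by rewrite addr_ge0// ltW.
pose n := Num.bound B; have Bn : B < n%:R by exact: archi_boundP.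
have nkn : n%:R <= (k n)%:R :> R by rewrite ler_nat.
have [_ _ Hn] := Htt (k n); apply: (Hn ((k n)%:R + h)); last first.
- have N2 : 0 < 2 * N by lra.
  apply: (close_on_trans N0); last first.
    apply: close_on_sym; apply: close_on_le (Hk2 n).2 => //.
    by move: Bn; rewrite /B -(natr1 n); lra.
  have -> : (tt (k n)).1 + ((k n)%:R + h) = ((tt (k n)).1 + (k n)%:R) + h by ring.
  apply: (close_on_trans N2); last exact: close_on_sym ch.
  rewrite -shiftD; apply: close_on_shift (cg n) => //.
  by move: Bn; rewrite /B -(natr1 n); lra.
- have := ler_norm (- h); have := ler_norm h; rewrite normrN.
  by move=> h1 h2; move: Bn; rewrite /B => Bn; apply/andP; lra.
Qed.

End Translates.

(** * Asymptotic spread of the bounded solution *)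

Section BoundedSolution.
Context {R : realType}.
Context (f : CRR R) (u0 M : R) (phi : R -> R)
  (lagrange : pos_Lagrange_stable f) (minimal : minimal_omega f)
  (monotone : monotone_field f) (sol : solution f u0 phi)
  (bounded : forall t, 0 <= t -> `|phi t| <= M).

Lemma asymptotic_spread : exists D : R,
  [/\ 0 <= D,
   forall e, 0 < e -> exists2 K, 0 < K & forall a b, K <= a -> K <= b ->
     close_on K (shift a f) (shift b f) -> phi a - phi b < D + e &
   forall e K, 0 < e -> 0 < K -> exists a b, [/\ K <= a, K <= b,
     close_on K (shift a f) (shift b f) & D - e < phi a - phi b]].
Proof.
pose A K := [set d | exists a b, [/\ K <= a, K <= b,
  close_on K (shift a f) (shift b f) & d = phi a - phi b]].
have A0 K : 0 < K -> A K 0.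
  by move=> K0; exists K, K; split; rewrite ?subrr//; exact: close_on_refl.
have hsA K : 0 < K -> has_sup (A K).
  move=> K0; split; first by exists 0; exact: A0.
  exists (2 * M) => _ [a [b [Ka Kb _ ->]]].
  have := bounded (ltW (lt_le_trans K0 Ka)).
  have := bounded (ltW (lt_le_trans K0 Kb)).
  by rewrite !ler_norml => /andP[? ?] /andP[? ?]; lra.
(* The sets [A K] shrink as [K] grows, so the infimum of their suprema is also the limit. *)
pose W := [set sup (A K) | K in [set K | 0 < K]].
have lW : lbound W 0.
  by move=> _ [K /= K0 <-]; apply: ub_le_sup; [exact: (hsA _ K0).2 | exact: A0].
have iW : has_inf W by split; [exists (sup (A 1)), 1 => /= | exists 0].
exists (inf W); split.
- by apply: lb_le_inf => //; exact: iW.1.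
- move=> e e0; have [_ [K /= K0 <-] WK] := inf_adherent e0 iW.
  exists K => // a b Ka Kb c; apply: le_lt_trans WK.
  by apply: ub_le_sup; [exact: (hsA _ K0).2 | exists a, b].
- move=> e K e0 K0; have [_ [a [b [Ka Kb c ->]]] h] := sup_adherent e0 (hsA _ K0).
  exists a, b; split => //; apply: le_lt_trans h.
  by rewrite lerD2r; apply: ge_inf; [exact: iW.2 | exists K].
Qed.

(** One nearly extremal pair serves every late [t]: a move by some [r <= S] brings [f^(a + r)] near
    [f^t], [f^(b + r)] follows since [f^a] and [f^b] are close, and the gap loses at most
    [r / K]. *)
Lemma spread_recurs (D e N : R) :
  (forall e K, 0 < e -> 0 < K -> exists a b, [/\ K <= a, K <= b,
     close_on K (shift a f) (shift b f) & D - e < phi a - phi b]) ->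
  0 < e -> e <= D -> 0 < N -> exists T, forall t, T <= t ->
    exists a b, [/\ N <= a, N <= b, close_on N (shift a f) (shift t f),
      close_on N (shift b f) (shift t f) & close_on N (shift a f) (shift b f) /\
      D - e < phi a - phi b].
Proof.
move=> lower e0 eD N0.
have N2 : 0 < 2 * N by lra.
have N4 : 0 < 2 * (2 * N) by lra.
have [S [T [S0 HST]]] := minimal_omega_recurrence lagrange minimal N4.
(* In turn: closeness survives a shift by up to [S], the state stays in the box, the loss [r / K] is
   at most [e / 2], and recurrence applies after [T]. *)
pose K := Num.max (Num.max (2 * (2 * N) + S) M) (Num.max (2 * S / e) T).
have KN : 2 * (2 * N) + S <= K by rewrite !le_max lexx.
have KM : M <= K by rewrite !le_max lexx orbT.
have KS : 2 * S / e <= K by rewrite !le_max lexx !orbT.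
have KT : T <= K by rewrite !le_max lexx !orbT.
have K0 : 0 < K by lra.
have e2 : 0 < e / 2 by lra.
have [a [b [Ka Kb cab gap]]] := lower _ _ e2 K0.
exists T => t Tt.
have [r /andP[r0 rS] cat] := HST a t (le_trans KT Ka) Tt.
have rK : r / K <= e / 2.
  rewrite ler_pdivrMr//; move: KS; rewrite ler_pdivrMr//; lra.
have r_in : 0 <= r <= K by rewrite r0/=; lra.
have car : close_on (2 * (2 * N)) (shift (a + r) f) (shift (b + r) f).
  by rewrite -!shiftD; apply: close_on_shift cab => //; rewrite ger0_norm//; lra.
have cbt : close_on (2 * N) (shift (b + r) f) (shift t f).
  exact: close_on_trans (close_on_sym car) cat.
have le24 : N <= 2 * (2 * N) by lra.
have le2 : N <= 2 * N by lra.
exists (a + r), (b + r); split; [lra|lra|exact: close_on_le cat| |split].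
- exact: close_on_le cbt.
- exact: close_on_le car.
- have := solution_gap monotone sol bounded K0 KM (lt_le_trans K0 Ka)
    (lt_le_trans K0 Kb) cab r_in (ltac:(lra)).
  lra.
Qed.

Lemma solution_remote_modulus (eps : R) : 0 < eps -> exists2 N : R, 0 < N &
  forall s, 0 <= s ->
    (exists L, forall t, L <= t -> close_on N (shift (t + s) f) (shift t f)) ->
    exists2 L, 0 < L & forall t, L <= t -> `|phi (t + s) - phi t| < eps.
Proof.
move=> eps0; have [D [D0 upper lower]] := asymptotic_spread.
(* Without spread, the upper bound for [(t + s, t)] and [(t, t + s)] already suffices. *)
have [D_eq0|/negPf Dn0] := eqVneq D 0.
  have [K K0 HK] := upper _ eps0; exists K => // s s0 [L HL].
  exists (Num.max K L); first by rewrite lt_max K0.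
  move=> t; rewrite ge_max => /andP[Kt Lt].
  have Kts : K <= t + s by lra.
  rewrite ltr_distl; have c := HL t Lt.
  have h1 := HK _ _ Kts Kt c; have h2 := HK _ _ Kt Kts (close_on_sym c).
  by apply/andP; lra.
have {Dn0}Dpos : 0 < D by rewrite lt_neqAle D0 eq_sym Dn0.
(* The errors below add up to at most [6 * e]; [4 * e <= D] makes the gap [phi a - phi b] exceed
   [e]. *)
pose e := Num.min (eps / 20) (D / 4).
have e0 : 0 < e by rewrite lt_min; apply/andP; lra.
have e_eps : 20 * e <= eps.
  have : e <= eps / 20 by rewrite ge_min lexx.
  lra.
have eD : 4 * e <= D.
  have : e <= D / 4 by rewrite ge_min lexx orbT.
  lra.
have [K0 K00 HK0] := upper _ e0.
have N20 : 0 < 2 * K0 by lra.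
have N40 : 0 < 2 * (2 * K0) by lra.
(* Two uses of [close_on_trans] lead down from this value to [K0]. It is fixed before [s]; only the
   [K] below depends on [s], with [s / e] making the drift [s / K] at most [e]. *)
exists (2 * (2 * K0)) => // s s0 [L HL].
pose K := Num.max (Num.max (2 * (2 * K0) + s) M) (s / e).
have K4 : 2 * (2 * K0) + s <= K by rewrite !le_max lexx.
have KM : M <= K by rewrite !le_max lexx orbT.
have Ks : s / e <= K by rewrite !le_max lexx orbT.
have Kp : 0 < K by lra.
have sK : s / K <= e by rewrite ler_pdivrMr// mulrC -ler_pdivrMr.
have sK0 : 0 <= s / K by rewrite divr_ge0// ltW.
have s_in : 0 <= s <= K by rewrite s0/=; lra.
have [T HT] := spread_recurs lower e0 (ltac:(lra)) Kp.
exists (Num.max (Num.max T L) K); first by rewrite lt_max Kp orbT.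
move=> t; rewrite ge_max => /andP[+ Kt]; rewrite ge_max => /andP[Tt Lt].
have [a [b [Ka Kb cat cbt [cab gap]]]] := HT t Tt.
pose near_t x := K0 <= x /\ close_on (2 * K0) (shift x f) (shift t f).
have spread_t x y : near_t x -> near_t y -> phi x - phi y < D + e.
  move=> [Kx cx] [Ky cy]; apply: HK0 => //.
  exact: close_on_trans cx (close_on_sym cy).
have moved x : K <= x -> close_on K (shift x f) (shift t f) ->
    near_t x /\ near_t (x + s).
  move=> Kx cx; split; split; [lra| |lra|].
    by apply: close_on_le cx => //; lra.
  apply: close_on_trans (HL t Lt) => //; rewrite -!shiftD.
  by apply: close_on_shift cx => //; rewrite ger0_norm.
have [na nas] := moved a Ka cat.
have [nb nbs] := moved b Kb cbt.
have [nt nts] := moved t Kt (close_on_refl _ Kp).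
have flow x y : K <= x -> K <= y -> close_on K (shift x f) (shift y f) ->
    phi x - phi y <= e \/ phi x - phi y - e <= phi (x + s) - phi (y + s).
  move=> Kx Ky cxy; have [|gt] := leP (phi x - phi y) e; [by left | right].
  have := solution_gap monotone sol bounded Kp KM (lt_le_trans Kp Kx)
    (lt_le_trans Kp Ky) cxy s_in.
  by move=> /(_ (le_lt_trans sK gt)); lra.
have fab := flow a b Ka Kb cab.
have fat := flow a t Ka Kt cat.
have ftb := flow t b Kt Kb (close_on_sym cbt).
have h1 := spread_t _ _ na nt.
have h2 := spread_t _ _ nt nb.
have h3 := spread_t _ _ nas nts.
have h4 := spread_t _ _ nts nbs.
have h5 := spread_t _ _ na nbs.
have h6 := spread_t _ _ nas nb.
(* [h5], [h6] and [fab] pin [phi (a + s)] and [phi (b + s)] near [phi a] and [phi b]. If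
   [phi a - phi t <= e], [flow] says nothing about that pair, and [h4] bounds [phi (t + s)] above
   instead; symmetrically, [h3] bounds it below if [phi t - phi b <= e]. *)
rewrite ltr_distl; apply/andP.
by case: fab => ?; case: fat => ?; case: ftb => ?; lra.
Qed.

End BoundedSolution.

(** * From remote recurrence of the field to closeness of its translates *)

Section FieldRecurrence.
Context {R : realType}.
Implicit Types (f : CRR R).

(** The delay [N] absorbs times [t + r] with [r] as low as [- N]. *)
Lemma eventually_close_on_shift f (s L N : R) :
  (forall t u, L <= t -> - N <= u <= N -> `|f (t + s, u) - f (t, u)| < N^-1) ->
  forall t, L + N <= t -> close_on N (shift (t + s) f) (shift t f).
Proof.
move=> H t Lt r x hr hx; rewrite !shiftE addrA; apply: H.
  by move: hr; rewrite ler_norml => /andP[? ?]; lra.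
by rewrite -ler_norml.
Qed.

Lemma field_remotely_periodic_close_on f (tau N : R) : 0 < N ->
  field_remotely_periodic tau f ->
  exists L, forall t, L <= t -> close_on N (shift (t + tau) f) (shift t f).
Proof.
move=> N0 per; have := per _ (@segment_compact R (- N) N).
have N0' : 0 < N^-1 by rewrite invr_gt0.
move=> /cvgrPdist_lt/(_ _ N0')[L [_ HL]].
exists (L + 1 + N); apply: eventually_close_on_shift => t u Lt Qu.
have Lt' : L < t by lra.
apply: le_lt_trans (HL t Lt'); rewrite sub0r normrN.
apply: le_trans (ler_norm _); apply: ub_le_sup; last by exists u; rewrite //= in_itv.
(* [sup] dominates the values only when they are bounded above, which continuity on the segment
   provides. *)
have slice (c : R) : continuous (fun v : R => f (c, v)).
  move=> v; apply: (@continuous_comp _ _ _ (fun v : R => (c, v)) f).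
    by apply: (cvg_pair (f := fun=> c) (g := id) (G := nbhs c) (H := nbhs v)); [exact: cvg_cst | exact: cvg_id].
  exact: cts_fun.
have cont : {within `[- N, N], continuous
    (fun v => `|f (t + tau, v) - f (t, v)|)}.
  apply: continuous_subspaceT => v; apply: cvg_norm.
  by apply: cvgB; exact: slice.
have NN : - N <= N by lra.
have [c _ cmax] := EVT_max NN cont.
by exists `|f (t + tau, c) - f (t, c)| => _ [v Qv <-]; apply: cmax.
Qed.

End FieldRecurrence.

Theorem theorem4p7 (R : realType) (f : CRR R) (u0 : R) (phi : R -> R) :
  pos_Lagrange_stable f ->
  minimal_omega f ->
  monotone_field f ->
  regular_field f ->
  solution f u0 phi ->
  bounded_on_Rplus phi ->
  (field_remotely_almost_periodic f -> remotely_almost_periodic phi) /\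
  (forall tau : R, 0 < tau ->
     field_remotely_periodic tau f -> remotely_periodic tau phi) /\
  (field_remotely_stationary f -> remotely_stationary phi).
Proof.
move=> lag mini mono _ sol [M bnd].
have cphi := solution_continuous sol.
have modulus := solution_remote_modulus lag mini mono sol bnd.
have periodic tau : 0 < tau ->
    field_remotely_periodic tau f -> remotely_periodic tau phi.
  move=> tau0 per; split => //; apply/cvgrPdist_lt => e e0.
  have [N N0 HN] := modulus e e0.
  have [L L0 HL] := HN tau (ltW tau0) (field_remotely_periodic_close_on N0 per).
  exists L; split; first exact: num_real.
  by move=> t Lt; rewrite /= sub0r normrN normr_id; apply/HL/ltW.
split; last by split => [//|stat tau tau0]; exact: periodic (stat tau tau0).
move=> rap; split => // e e0; have [N N0 HN] := modulus e e0.
have N0' : 0 < N^-1 by rewrite invr_gt0.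
have [l l0 Hl] := rap _ _ N0' (@segment_compact R (- N) N).
(* [phi] inherits [l] from the field; [a0] makes [s] nonnegative, as [HN] requires. *)
exists l => // a a0; have [s as_ [L _ HL]] := Hl a; exists s => //.
apply: HN; first by case/andP: as_ => ? _; lra.
exists (L + N); apply: eventually_close_on_shift => t u Lt uN; apply: HL => //.
Qed.
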